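(* The set $X'$ has infinitely many elements.
   Context: For a positive integer $n$, $\sigma(n)$ denotes the sum of the positive divisors of $n$, and $\log$ is the natural logarithm. The set $X'$ of positive integers is defined recursively as follows. Let $n_1=10080$. Given $n_k$, let $n_{k+1}$ be the least integer $n>n_k$ (if such an integer exists; otherwise the construction stops) satisfying $$\frac{\sigma(n)/n}{\sigma(n_k)/n_k}>1+\frac{\log (n/n_k)}{\log n\,\log\log n_k}.$$ Then $X'$ is the set of all the integers $n_1,n_2,n_3,\ldots$ so obtained. *)

(* Defs.v *)
From mathcomp Require Import all_boot all_order all_algebra.
From mathcomp Require Import all_classical all_reals all_analysis.

Set Implicit Arguments.
Unset Strict Implicit.
Unset Printing Implicit Defensive.

Import Order.TTheory GRing.Theory Num.Theory.

Local Open Scope classical_set_scope.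
Local Open Scope ring_scope.

Definition sigma (n : nat) : nat := (\sum_(d <- divisors n) d)%N.

Definition abundancy (R : realType) (n : nat) : R := (sigma n)%:R / n%:R.

Definition candidate (R : realType) (m n : nat) : Prop :=
  (m < n)%N /\
  abundancy R n / abundancy R m
    > 1 + ln (n%:R / m%:R : R) / (ln (n%:R : R) * ln (ln (m%:R : R))).

Definition next_term (R : realType) (m n : nat) : Prop :=
  candidate R m n /\ forall j : nat, candidate R m j -> (n <= j)%N.

(* [term R k n] says that the construction reaches a [k]-th term n_k (counting
   from k = 1) and that n_k = n. It is a relation because the construction
   might stop, in which case [term R k] is empty from some [k] on. *)
Inductive term (R : realType) : nat -> nat -> Prop :=
| term_first : term R 1 10080
| term_next (k m n : nat) : term R k m -> next_term R m n -> term R k.+1 n.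

Definition X' (R : realType) : set nat := [set n | exists k, term R k n].

(* Main.v *)
(* For m >= 10080 and n > m, ln (n / m) < ln n, so the right-hand side of the
   selection inequality stays below 1 + 1 / ln (ln m), whereas sigma(n) / n is
   unbounded: it dominates a harmonic sum when n is a factorial.  Hence the
   construction never stops. *)
Require Import Defs.
From mathcomp Require Import all_boot all_order all_algebra.
From mathcomp Require Import all_classical all_reals all_analysis.

Set Implicit Arguments.
Unset Strict Implicit.
Unset Printing Implicit Defensive.

Import Order.TTheory GRing.Theory Num.Theory.

Local Open Scope classical_set_scope.
Local Open Scope ring_scope.

(** Having no repetition, [s] is a permutation of a filtered [divisors n], so its sum is part of the
    sum for [sigma n]. *)
Lemma leq_sum_divisors_sigma (s : seq nat) (n : nat) :
  (0 < n)%N -> uniq s -> all (dvdn^~ n) s -> (\sum_(d <- s) d <= sigma n)%N.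
Proof.
move=> n_gt0 s_uniq /allP s_dvd; rewrite /sigma.
have perm_s : perm_eq s [seq d <- divisors n | d \in s].
  apply: uniq_perm => //; first by rewrite filter_uniq// divisors_uniq.
  move=> d; rewrite mem_filter -dvdn_divisors//.
  by case: (boolP (d \in s)) => //= /s_dvd ->.
by rewrite (perm_big _ perm_s)/= big_filter (bigID (mem s) predT)/= leq_addr.
Qed.

(** The quotients [N!/i] for [1 <= i <= N] are distinct divisors of [N!]; divided by [N!] they
    become the terms [1/i]. *)
Lemma series_harmonic_le_abundancy_fact (R : realType) (N : nat) :
  series (@harmonic R) N <= abundancy R N`!.
Proof.
have N_fact : (0 < N`!)%N := fact_gt0 N.
have dvd_fact i : (i < N)%N -> (i.+1 %| N`!)%N by move=> ?; rewrite dvdn_fact.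
pose s := [seq (N`! %/ i.+1)%N | i <- iota 0 N].
have : (\sum_(d <- s) d <= sigma N`!)%N.
  apply: leq_sum_divisors_sigma => //.
    rewrite map_inj_in_uniq ?iota_uniq// => i j.
    rewrite !mem_iota/= !add0n => /dvd_fact di /dvd_fact dj eq_div.
    (* Both [i.+1] and [j.+1] times the common quotient give [N!]; that quotient is positive, so it
       cancels. *)
    have := divnK di; rewrite eq_div -(divnK dj) => /eqP.
    rewrite mulnK//.
    rewrite eqn_pmul2l; first by move/eqP => [].
    by rewrite divn_gt0// dvdn_leq.
  apply/allP => _ /mapP[i + ->]; rewrite mem_iota/= add0n => /dvd_fact di.
  exact: dvdn_div.
rewrite /abundancy ler_pdivlMr ?ltr0n// -(ler_nat R) => /(le_trans _); apply.
rewrite big_map natr_sum /series/= /index_iota subn0 mulr_suml !big_seq.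
apply: ler_sum => i; rewrite mem_iota/= add0n => /dvd_fact di.
rewrite -{1}(divnK di) natrM mulrCA mulVf ?mulr1// pnatr_eq0//.
Qed.

Lemma abundancy_unbounded (R : realType) (A : R) (m : nat) :
  exists2 n, (m < n)%N & A < abundancy R n.
Proof.
have /cvgryPgt/(_ A) harmonic_gt : series (@harmonic R) @ \oo --> +oo.
  apply: nondecreasing_dvgn_lt; last exact: dvg_harmonic.
  by apply: nondecreasing_series => i _ _; exact: harmonic_ge0.
(* The index must reach [N] for the harmonic sum to exceed [A], and [m.+1] for the factorial to
   exceed [m]. *)
have [N _ /(_ (maxn N m.+1) (leq_maxl _ _)) /= gtA] := harmonic_gt.
exists (maxn N m.+1)`!; last first.
  exact: lt_le_trans gtA (series_harmonic_le_abundancy_fact _ _).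
apply: leq_trans (leq_maxr N m.+1) _; rewrite dvdn_leq ?fact_gt0//.
by rewrite dvdn_fact// leqnn andbT (leq_trans _ (leq_maxr _ _)).
Qed.

Lemma abundancy_gt0 (R : realType) (n : nat) : (0 < n)%N -> 0 < abundancy R n.
Proof.
move=> n_gt0; rewrite divr_gt0 ?ltr0n//.
rewrite (leq_trans n_gt0)//.
have := @leq_sum_divisors_sigma [:: n] n n_gt0 isT.
by rewrite /= dvdnn big_seq1; exact.
Qed.

(** This makes [ln (ln m)] positive. The threshold 4 is a crude upper bound for e, ample for terms
    starting at 10080. *)
Lemma ln_gt1 (R : realType) (m : nat) : (4 < m)%N -> 1 < ln (m%:R : R).
Proof.
move=> m_gt4; rewrite -[ltLHS]expRK ltr_ln ?posrE ?expR_gt0 ?ltr0n//; last first.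
  exact: leq_ltn_trans m_gt4.
(* [expR (-1/2) >= 1/2], so [expR 1 <= 4]. *)
have le4 : expR 1 <= 4%:R :> R.
  have half : 2^-1 <= expR (- 2^-1) :> R.
    have := expR_ge1Dx (- 2^-1 : R); apply: le_trans.
    by rewrite {2}(splitr 1) div1r addrK.
  rewrite -[expR 1]invrK -expRN -[leRHS]invrK lef_pV2 ?posrE ?expR_gt0 ?invr_gt0//.
  rewrite [1 in leRHS](splitr 1) div1r opprD expRD.
  have -> : 4%:R^-1 = 2^-1 * 2^-1 :> R by rewrite -invfM -natrM.
  by rewrite ler_pM.
by apply: le_lt_trans le4 _; rewrite ltr_nat.
Qed.

Lemma candidate_exists (R : realType) (m : nat) :
  (4 < m)%N -> exists n, candidate R m n.
Proof.
move=> m_gt4; have m_gt0 : (0 < m)%N by exact: leq_ltn_trans m_gt4.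
have lnln_gt0 : 0 < ln (ln (m%:R : R)) by rewrite ln_gt0// ln_gt1.
(* The target does not depend on [n], which is what allows [n] to be chosen afterwards. *)
have [n mn n_gt] :=
  abundancy_unbounded ((1 + (ln (ln (m%:R : R)))^-1) * abundancy R m) m.
exists n; split => //.
rewrite ltr_pdivlMr ?abundancy_gt0//; apply: le_lt_trans n_gt.
rewrite ler_pM2r ?abundancy_gt0// lerD2l.
have n_gt0 : (0 < n)%N by exact: ltn_trans mn.
have lnn_gt0 : 0 < ln (n%:R : R).
  by apply: lt_trans (ln_gt1 R (ltn_trans m_gt4 mn)); exact: ltr01.
(* Split off the factor [ln (n/m) / ln n], which is at most 1 because [m >= 1]. *)
rewrite invfM mulrA ler_piMl ?invr_ge0 ?(ltW lnln_gt0)//.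
rewrite ler_pdivrMr// mul1r ler_ln ?posrE ?divr_gt0 ?ltr0n//.
by rewrite ler_pdivrMr ?ltr0n// ler_peMr ?ler0n// ler1n.
Qed.

Lemma next_term_exists (R : realType) (m : nat) :
  (4 < m)%N -> exists n, next_term R m n.
Proof.
move=> m_gt4; have [n0 cand] := candidate_exists R m_gt4.
(* Classical reflection makes the real inequality a boolean predicate, so that a least candidate can
   be extracted. *)
have ex : exists n, `[< candidate R m n >] by exists n0; apply/asboolP.
case: (ex_minnP ex) => n /asboolP cand_n n_min.
by exists n; split=> // j cand_j; apply: n_min; apply/asboolP.
Qed.

(** Terms increase by at least 1 at each step. The bound serves twice: it keeps terms above 4, so
    that the induction continues, and it makes them unbounded. *)
Lemma term_exists (R : realType) (k : nat) :
  exists2 n, term R k.+1 n & (k + 4 < n)%N.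
Proof.
elim: k => [|k [m term_m lt_m]]; first by exists 10080%N => //; exact: term_first.
have m_gt4 : (4 < m)%N by exact: leq_ltn_trans (leq_addl _ _) lt_m.
have [n next_n] := next_term_exists R m_gt4.
exists n; first exact: term_next term_m next_n.
by rewrite addSn; case: next_n => -[mn _] _; exact: leq_ltn_trans mn.
Qed.

Theorem theorem1p5 (R : realType) : infinite_set (X' R).
Proof.
move=> /finite_seqP[s X'_s].
(* If [s] lists all of [X'], a term whose index is past the maximum of [s] exceeds every entry of
   [s]. *)
have [n term_n lt_n] := term_exists R (\max_(i <- s) i).
have : X' R n by exists (\max_(i <- s) i).+1.
rewrite X'_s /= => n_s.
have : (n <= \max_(i <- s) i)%N by exact: (@leq_bigmax_seq _ _ xpredT id).
rewrite leqNgt => /negP; apply.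
exact: leq_ltn_trans (leq_addr _ _) lt_n.
Qed.
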